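(* If $\kappa<\mathfrak{par}_2$ is a cardinal and $\mathcal{B}$ is a barrier on $\omega$, then $2^\kappa$ is $\mathcal{B}$-sequentially compact. Moreover, $$\mathfrak{par}_2=\min\{\kappa:2^\kappa\text{ is not }\mathcal{B}\text{-sequentially compact}\}$$ for every non-trivial barrier $\mathcal{B}$ on $\omega$.
   Context: $2^\kappa$ is the Cantor cube with the product topology. For sets of naturals, $s\sqsubseteq t$ means $s$ is an initial segment of $t$. For $\mathcal{F}\subseteq[\omega]^{<\omega}$ and $M\subseteq\omega$ let $\mathcal{F}|M=\{s\in\mathcal{F}:s\subseteq M\}$. A barrier on an infinite set $M\subseteq\omega$ is a family $\mathcal{B}$ of nonempty finite subsets of $M$ such that (a) $s\subseteq t$ implies $s=t$ for $s,t\in\mathcal{B}$, and (b) every infinite $N\subseteq M$ has an initial segment $s\sqsubseteq N$ with $s\in\mathcal{B}$. A barrier on $\omega$ is non-trivial if $\mathcal{B}\neq[\omega]^1$. If $\mathcal{B}$ is a barrier on an infinite set $M$, $f:\mathcal{B}\to X$ converges to $x\in X$ if for every open $U\ni x$ there is $n\in\omega$ with $f[\mathcal{B}|(M\setminus n)]\subseteq U$. For a barrier $\mathcal{B}$ on $\omega$, $X$ is $\mathcal{B}$-sequentially compact if for every $f:\mathcal{B}\to X$ there is an infinite $M\subseteq\omega$ such that $f\restriction(\mathcal{B}|M)$ converges to some point of $X$. $\mathfrak{par}_2$ is the minimum size of a collection $\Pi$ of colorings $\pi:[\omega]^2\to2$ for which there is no infinite $H\subseteq\omega$ such that for every $\pi\in\Pi$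 there is a finite $F\subseteq H$ with $\pi$ constant on $[H\setminus F]^2$. *)

(* Defs.v *)
From mathcomp Require Import all_boot finmap.
From mathcomp Require Import all_classical topology.

Set Implicit Arguments.
Unset Strict Implicit.
Unset Printing Implicit Defensive.

Local Open Scope classical_set_scope.
Local Open Scope card_scope.

(* A cardinal is represented by a type,
   considered up to equinumerosity. *)

Definition card_lt (K L : Type) : Prop :=
  [set: K] #<= [set: L] /\ ~ ([set: L] #<= [set: K]).

(* [L] has the least cardinality among the types satisfying [C]. *)
Definition is_min_card (C : Type -> Prop) (L : Type) : Prop :=
  C L /\ forall K : Type, C K -> [set: L] #<= [set: K].

Definition cantor_cube (K : Type) : topologicalType :=
  prod_topology (fun _ : K => bool).

Definition initial_segment (s t : set nat) : Prop :=
  s `<=` t /\ forall m n, s n -> t m -> (m < n)%N -> s m.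

Definition restrict_family (F : set {fset nat}) (M : set nat)
    : set {fset nat} :=
  [set s | F s /\ [set` s] `<=` M].

Definition barrier (M : set nat) (B : set {fset nat}) : Prop :=
  [/\ infinite_set M,
      forall s, B s -> s != fset0%fset /\ [set` s] `<=` M,
      forall s t, B s -> B t -> (s `<=` t)%fset -> s = t
    & forall N : set nat, infinite_set N -> N `<=` M ->
        exists2 s, B s & initial_segment [set` s] N].

Definition nontrivial_barrier (B : set {fset nat}) : Prop :=
  barrier [set: nat] B /\ B <> [set s | #|` s| = 1%N].

(* A map defined on the family [B] is represented by a total function, of which
   only the values on [B] matter. *)
Definition barrier_cvg (X : topologicalType) (M : set nat)
    (B : set {fset nat}) (f : {fset nat} -> X) (x : X) : Prop :=
  forall U : set X, open U -> U x ->
    exists n : nat, f @` restrict_family B (M `\` `I_n) `<=` U.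

Definition barrier_seq_compact (B : set {fset nat}) (X : topologicalType)
    : Prop :=
  forall f : {fset nat} -> X, exists2 M : set nat, infinite_set M &
    exists x : X, barrier_cvg M (restrict_family B M) f x.

Definition pairs : Type := {s : {fset nat} | #|` s| == 2%N}.

Definition coloring : Type := pairs -> bool.

Definition almost_homogeneous (H : set nat) (p : coloring) : Prop :=
  exists2 F : {fset nat}, [set` F] `<=` H &
    exists c : bool, forall s : pairs,
      [set` val s] `<=` H `\` [set` F] -> p s = c.

Definition par2_witness (Pi : set coloring) : Prop :=
  ~ exists2 H : set nat, infinite_set H &
      forall p, Pi p -> almost_homogeneous H p.

(* Cardinals are well-ordered. *)
Lemma exists_min_card_set (T : Type) (P : set (set T)) : P !=set0 ->
  exists2 A, P A & forall B, P B -> A #<= B.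
Proof.
move=> [A0 PA0].
pose good (S : set (set T -> T)) :=
  (forall g, S g -> forall B, P B -> B (g B)) /\
  (forall B, P B -> forall g h, S g -> S h -> g B = h B -> g = h).
have [|S [[Sin Sinj] Smax]] := @Zorn_bigcup _ good.
  move=> F Fgood Ftot; split=> [g [S FS Sg]|B PB g h [S FS Sg] [S' FS' S'h]].
    exact: (Fgood _ FS).1.
  case: (Ftot _ _ FS FS') => SS'.
    by apply: (Fgood _ FS').2 => //; exact: SS'.
  by apply: (Fgood _ FS).2 => //; exact: SS'.
have [[A PA Asurj]|noA] :=
    pselect (exists2 A, P A & forall a, A a -> exists2 g, S g & g A = a).
  exists A => // B PB; apply: (@card_le_trans _ _ _ S).
    apply: card_le_trans (card_image_le (fun g => g A) S).
    by apply: subset_card_le => a /Asurj[g Sg <-]; exists g.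
  have Seq : (fun g => g B) @` S #= S.
    apply: inj_card_eq => g h /set_mem Sg /set_mem Sh gh.
    exact: (Sinj B).
  rewrite -(card_le_eql Seq); apply: subset_card_le => _ [g Sg <-].
  exact: (Sin g).
have missing A : P A -> exists a, A a /\ forall g, S g -> g A <> a.
  move=> PA; apply: contrapT => noa; apply: noA; exists A => // a Aa.
  apply: contrapT => nog; apply: noa; exists a; split => // g Sg gA.
  by apply: nog; exists g.
have [a0 _] := missing _ PA0.
have /choice[g0 g0P] : forall A, exists a,
    P A -> A a /\ forall g, S g -> g A <> a.
  move=> A; have [PA|nPA] := pselect (P A); last by exists a0.
  by have [a aP] := missing _ PA; exists a.
exfalso; have : S `<` S `|` [set g0].
  split; first exact: subsetUl.
  move=> /(_ g0 (or_intror erefl)) Sg0.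
  by have [_ /(_ _ Sg0)] := g0P _ PA0.
move=> /Smax; apply; split=> [g [Sg|->] B PB|B PB g h [Sg|->] [Sh|->] //].
- exact: (Sin g).
- exact: (g0P _ PB).1.
- exact: (Sinj B).
- by move=> gh; have [_ /(_ _ Sg)] := g0P _ PB.
- by move=> gh; have [_ /(_ _ Sh)] := g0P _ PB; rewrite gh.
Qed.

Lemma infinite_set_pair (D : set nat) : infinite_set D ->
  exists s : pairs, [set` val s] `<=` D.
Proof.
move=> Dinf; have [x Dx] := infinite_setN0 Dinf.
have /infinite_setN0[y [Dy /= /eqP yx]] : infinite_set (D `\` [set x]).
  exact: infinite_setD.
have sz : #|` [fset x; y]%fset| == 2%N by rewrite cardfs2 [x == y]eq_sym yx.
by exists (exist (fun s : {fset nat} => #|` s| == 2) _ sz) => z /=;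
  rewrite !inE => /orP[] /eqP->.
Qed.

Lemma par2_witnessT : par2_witness [set: coloring].
Proof.
move=> [H Hinf allH].
have /infiniteP/pcard_leP/unsquash h := Hinf.
have hH n : H (h n) by apply: (funS _).
have hI : injective h by move=> m n /inj ->//; rewrite ?inE.
pose A (i : bool) := (fun n => h (n.*2 + i)) @` [set: nat].
have Ainf i : infinite_set (A i).
  apply/infiniteP; rewrite (card_le_eqr (inj_card_eq _))//.
  by move=> m n _ _ /hI /addIn /double_inj.
have AH i : A i `<=` H by move=> _ [n _ <-].
have A01 x : A true x -> ~ A false x.
  by move=> [m _ <-] [n _ /hI] /(congr1 odd); rewrite !oddD !odd_double.
pose p (s : pairs) := `[< [set` val s] `<=` A true >].
have [F _ [c pc]] := allH p I.
have mono i : exists s : pairs, [set` val s] `<=` A i `\` [set` F].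
  by apply: infinite_set_pair; apply: infinite_setD.
have cE i : c = i.
  have [s sA] := mono i.
  rewrite -(pc s); last by move=> x /sA[/AH].
  case: i sA => sA; first by apply/asboolP => x /sA[].
  apply/asboolPn => sT; case: s sA sT => s /= /eqP s2 sA sT.
  have [|x xs] := @fset0Pn _ s _.
    by apply/eqP => s0; rewrite s0 in s2.
  by apply: (A01 x); [exact: sT | case: (sA x xs)].
by have := cE true; rewrite (cE false).
Qed.

Lemma exists_min_par2_witness : exists2 Pi, par2_witness Pi &
  forall Pi', par2_witness Pi' -> Pi #<= Pi'.
Proof.
by apply: exists_min_card_set; exists [set: coloring]; exact: par2_witnessT.
Qed.

(* The cardinal par_2, as the type of the colorings in some collection of least
   size; [par2P] below is all that matters. *)
Definition par2 : Type := set_type (projT1 (cid2 exists_min_par2_witness)).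

Lemma par2P : is_min_card
  (fun K => exists2 Pi, par2_witness Pi & [set: K] #= Pi) par2.
Proof.
rewrite /par2; case: cid2 => Pi /= PiW Pimin; split.
  by exists Pi => //; exact: card_setT.
move=> K [Pi' Pi'W KPi']; rewrite (card_le_eql (card_setT _)).
by rewrite (card_le_eqr KPi'); exact: Pimin.
Qed.

(* Main.v *)
(* Let [K] be such that [par2] does not embed in it, so that any [K] colorings
   of pairs have a common almost homogeneous set. This handles at once two kinds
   of tasks on an infinite set [M]: coloring [a < b] by whether [g k a <= b]
   yields a set whose gaps eventually exceed each of [K] functions [g k], and
   coloring it by [c k a] yields a set on which each of [K] two-valued
   functions [c k] is eventually constant. Together they propagate almost
   homogeneity down the tree of finite subsets of the members of a barrier, from
   all the [a |` t] to [t]; a failure at the root would thus give an infinite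
   branch, whose union contains a member of the barrier, where homogeneity is
   trivial.
   Conversely, the members of a nontrivial barrier that avoid some finite set
   have at least two elements, and coloring each by the color of its first two
   elements turns convergence in the cube into almost homogeneity of colorings
   of pairs. *)

Require Import Defs.
From mathcomp Require Import all_boot finmap.
From mathcomp Require Import all_classical topology.
From mathcomp Require Import zify.
Set Implicit Arguments.
Unset Strict Implicit.
Unset Printing Implicit Defensive.

Local Open Scope classical_set_scope.
Local Open Scope card_scope.

(** * Convergence along a barrier in the Cantor cube *)

Lemma barrier_cvg_cubeP (K : Type) (M : set nat) (B : set {fset nat})
    (f : {fset nat} -> cantor_cube K) (x : cantor_cube K) :
  barrier_cvg M B f x <->
  forall k, exists n, forall s, B s -> [set` s] `<=` M `\` `I_n -> f s k = x k.
Proof.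
(* The sets containing the image of some tail form a filter. Barrier convergence is thus filter
   convergence, which a product topology tests one coordinate at a time; there, discreteness makes
   it eventual equality. *)
pose G : set_system (cantor_cube K) :=
  [set A | exists n, f @` restrict_family B (M `\` `I_n) `<=` A].
have mono m n : (m <= n)%N -> M `\` `I_n `<=` M `\` `I_m.
  by move=> mn i [Mi /= ni]; split=> // im; apply: ni; exact: leq_trans im mn.
have FG : Filter G.
  split.
  - by exists 0%N.
  - move=> P Q [m mP] [n nQ]; exists (maxn m n) => _ [s [Bs sM] <-]; split.
      apply: mP; exists s => //; split=> //; apply: subset_trans sM _.
      exact/mono/leq_maxl.
    apply: nQ; exists s => //; split=> //; apply: subset_trans sM _.
    exact/mono/leq_maxr.
  - by move=> P Q PQ [n nP]; exists n; exact: subset_trans PQ.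
have -> : barrier_cvg M B f x <-> G --> x.
  split=> [cvf U|cvf U oU Ux]; last exact/cvf/open_nbhs_nbhs.
  rewrite nbhsE => -[V [oV Vx] VU]; have [n nV] := cvf _ oV Vx.
  by exists n; exact: subset_trans VU.
split=> [cvx k|coord].
  have /cvg_sup/(_ k) xx : nbhs x --> x by [].
  have /xx/cvx[n nx] :
      nbhs (x : initial_topology (fun y : forall _ : K, bool => y k))
      [set y | y k = x k].
    apply: open_nbhs_nbhs; split=> //; exists [set x k] => //.
    exact: discrete_open.
  by exists n => s Bs sM; apply: nx; exists s.
apply/cvg_sup => k U [_ [[V oV <-] Vx] VU]; have [n nx] := coord k.
by exists n => _ [s [Bs sM] <-]; apply: VU => /=; rewrite (nx s).
Qed.

(** * Infinite sets of naturals and diagonalization *)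

Lemma infinite_natP (A : set nat) :
  infinite_set A <-> forall n, exists2 m, A m & (n <= m)%N.
Proof.
split=> [Ainf n|Aub Afin].
  have /infinite_setN0[m [Am /= /negP]] := infinite_setD Ainf (finite_II n).
  by rewrite -leqNgt; exists m.
have [X AX] := finite_fsetP.1 Afin.
have [m Am] := Aub (\max_(i <- X) i).+1.
rewrite leqNgt ltnS => /negP; apply; apply: (leq_bigmax_seq (F := id)) => //.
by move: Am; rewrite AX.
Qed.

Lemma infinite_set_enum (A : set nat) : infinite_set A ->
  exists2 e : nat -> nat, (forall n, A (e n)) &
    {homo e : m n / (m < n)%N}.
Proof.
move=> /infinite_natP Aub.
have /choice[g gP] : forall n, exists m, A m /\ (n <= m)%N.
  by move=> n; have [m] := Aub n; exists m.
pose e := fix e n := if n is n'.+1 then g (e n').+1 else g 0%N.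
exists e; first by case=> [|n] /=; apply: (gP _).1.
by apply: homo_ltn => [m n p|n] /=; [exact: ltn_trans | exact: (gP _).2].
Qed.

Lemma fset2_ltn_inj (a b a' b' : nat) : (a < b)%N -> (a' < b')%N ->
  [fset a; b]%fset = [fset a'; b']%fset -> a = a' /\ b = b'.
Proof.
move=> ab ab' /fsetP E.
have := E a; have := E b; have := E a'; have := E b'; rewrite !inE !eqxx ?orbT.
lia.
Qed.

Lemma fset_min (u : {fset nat}) : u != fset0 ->
  exists2 a, a \in u & forall b, b \in u -> (a <= b)%N.
Proof.
by move=> /fset0Pn uE; case: (ex_minnP uE) => a au amin; exists a.
Qed.

(** Shrink [M] successively to a decreasing sequence [A n] with [P n (A n)] and pick [h n] in [A n].
    The range of [h] is almost contained in every [A n], and the first hypothesis passes each [P n]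
    down to it. *)
Lemma diagonal_intersection (P : nat -> set nat -> Prop) :
  (forall n H H' k, H' `\` `I_k `<=` H -> P n H -> P n H') ->
  (forall n M, infinite_set M ->
     exists2 H, infinite_set H & H `<=` M /\ P n H) ->
  forall M, infinite_set M ->
    exists2 H, infinite_set H & H `<=` M /\ forall n, P n H.
Proof.
move=> Pmod Pdense M Minf.
have /choice[g gP] : forall nM : nat * set nat, exists H, infinite_set nM.2 ->
    infinite_set H /\ (H `<=` nM.2 /\ P nM.1 H).
  move=> -[n N] /=; have [Ninf|//] := pselect (infinite_set N).
    by have [H] := Pdense n N Ninf; exists H.
  by exists set0.
pose A := fix A n := g (n, if n is n'.+1 then A n' else M).
have Ainf n : infinite_set (A n).
  by elim: n => [|n IHn] /=;
    [have [] := gP (0%N, M) | have [] := gP (n.+1, A n)].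
have A0 : A 0 `<=` M by have [_ []] := gP (0%N, M) Minf.
have AS n : A n.+1 `<=` A n by have [_ []] := gP (n.+1, A n) (Ainf n).
have AP n : P n (A n).
  by case: n => [|n] /=; [have [_ []] := gP (0%N, M) Minf
                         |have [_ []] := gP (n.+1, A n) (Ainf n)].
have Amono m n : (m <= n)%N -> A n `<=` A m.
  move=> /subnK <-; elim: (n - m)%N => [//|k IHk] i /AS; exact: IHk.
have /choice[h hP] : forall n, exists m, A n m /\ (n <= m)%N.
  by move=> n; have [m] := (infinite_natP _).1 (Ainf n) n; exists m.
exists (range h); [|split].
- by apply/infinite_natP => n; exists (h n); [exists n | exact: (hP n).2].
- move=> _ [n _ <-]; apply/A0/(Amono 0%N n) => //; exact: (hP n).1.
(* Past the largest of the [h i] with [i < n], only values [h i] with [n <= i] remain, and those lie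
   in [A n]. *)
- move=> n; apply: (Pmod n (A n) _ (\max_(i < n) h i).+1 _ (AP n)).
  move=> _ [[i _ <-]] /= hi; have [ni|] := leqP n i.
    by apply: (Amono n i ni); exact: (hP i).1.
  move=> lin; exfalso; apply: hi; rewrite ltnS.
  exact: (leq_bigmax (Ordinal lin)).
Qed.

(** * Propagating homogeneity through a barrier *)

Section PairColorings.
Variable K : Type.
Hypothesis Klt : ~ ([set: par2] #<= [set: K]).

Lemma pair_homogeneous (p : K -> nat -> nat -> bool) (M : set nat) :
  infinite_set M -> exists2 H, infinite_set H & H `<=` M /\
    forall k, exists c n, forall a b,
      H a -> H b -> (n <= a)%N -> (a < b)%N -> p k a b = c.
Proof.
move=> /infinite_set_enum[e eM e_lt].
have e_le : {mono e : m n / (m <= n)%N} by exact: leq_mono.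
(* [p] is pulled back to the whole of the naturals along [e], each unordered pair being read in
   increasing order. There are at most [K] such colorings, too few for a witness. *)
pose q k : coloring := fun s => `[< exists a b,
  [/\ (a < b)%N, val s = [fset a; b]%fset & p k (e a) (e b)] >].
have /contrapT[H Hinf Hq] : ~ par2_witness (range q).
  move=> qW; apply: Klt.
  have qle : [set: par2] #<= [set: range q].
    by apply: par2P.2; exists (range q) => //; exact: card_setT.
  apply: card_le_trans qle _; rewrite (card_le_eql (card_setT _)).
  exact: card_image_le.
exists (e @` H); [|split; first by move=> _ [n _ <-]].
  apply/infinite_natP => n.
  have [m Hm nm] := (infinite_natP _).1 Hinf n; exists (e m); first by exists m.
  apply: leq_trans nm _; elim: m {Hm} => [//|m IHm].
  exact: leq_ltn_trans IHm (e_lt _ _ _).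
move=> k; have [|F _ [c qc]] := Hq (q k); first by exists k.
exists c, (e (\max_(i <- F) i).+1) => _ _ [a Ha <-] [b Hb <-].
rewrite e_le (leqW_mono e_le) => Fa ab.
have s2 : #|` [fset a; b]%fset| == 2%N by rewrite cardfs2 neq_ltn ab.
have notF i : (a <= i)%N -> ~ i \in F.
  move=> ai iF; have := leq_trans Fa ai.
  by rewrite ltnNge (leq_bigmax_seq (F := id)).
rewrite -(qc (exist (fun s : {fset nat} => #|` s| == 2%N) _ s2)); last first.
  move=> i /=; rewrite !inE => /orP[] /eqP ->; split=> //; apply: notF => //.
  exact: ltnW.
apply/idP/asboolP => [pab|[a' [b' [ab' /= E]]]]; first by exists a, b.
by have [-> ->] := fset2_ltn_inj ab ab' E.
Qed.

Variables (B : set {fset nat}) (f : {fset nat} -> K -> bool).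

(* All members of [B] that contain [t] and whose other elements are in [H] get
   the same color, up to finitely many elements of [H] for each [k]. *)
Definition homogeneous_above (t : {fset nat}) (H : set nat) : Prop :=
  forall k, exists c n, forall u : {fset nat}, [set` u] `<=` H `\` `I_n ->
    B (t `|` u)%fset -> f (t `|` u)%fset k = c.

Definition densely_homogeneous (t : {fset nat}) : Prop :=
  forall M, infinite_set M ->
    exists2 H, infinite_set H & H `<=` M /\ homogeneous_above t H.

Lemma homogeneous_above_mod t H H' n : H' `\` `I_n `<=` H ->
  homogeneous_above t H -> homogeneous_above t H'.
Proof.
move=> HH' Ht k; have [c [m mP]] := Ht k; exists c, (maxn m n) => u uH.
apply: mP => i /uH[H'i /= im]; split => /=.
  by apply: HH'; split => //= ni; apply: im; rewrite leq_max ni orbT.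
by move=> mi; apply: im; rewrite leq_max mi.
Qed.

(** As [t] is not in [B], only nonempty [u] matter. Splitting off the least element [a] of [u]
    reduces to homogeneity above [t] with [a] added, provided that the rest of [u] lies past a
    threshold depending on [a] and that the resulting color does not depend on [a]. *)
Lemma densely_homogeneous_step t : ~ B t ->
  (exists m, forall a, (m <= a)%N -> densely_homogeneous (a |` t)%fset) ->
  densely_homogeneous t.
Proof.
move=> nBt [m mP] M Minf.
pose P a H := (m <= a)%N -> homogeneous_above (a |` t)%fset H.
have [|a N Ninf|H Hinf [HM HP]] := @diagonal_intersection P _ _ M Minf.
- move=> a H H' n HH' + ma => /(_ ma); exact: (homogeneous_above_mod HH').
- have [ma|am] := leqP m a; last first.
    by exists N => //; split=> //; rewrite /P leqNgt am.
  by have [H Hinf [HN Ha]] := mP a ma N Ninf; exists H => //; split.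
have /choice[g gP] : forall ka : K * nat, exists cn : bool * nat,
    (m <= ka.2)%N -> forall u : {fset nat}, [set` u] `<=` H `\` `I_(cn.2) ->
    B (ka.2 |` t `|` u)%fset -> f (ka.2 |` t `|` u)%fset ka.1 = cn.1.
  move=> -[k a] /=; have [ma|am] := leqP m a; last by exists (true, 0%N).
  by have [c [n cn]] := HP a ma k; exists (c, n).
(* [H1] is sparse enough to outgrow every [fun a => (g (k, a)).2]; on [H2] the
   colors [(g (k, a)).1] eventually stabilize. *)
have [H1 H1inf [H1H H1P]] :=
  pair_homogeneous (fun k a b => ((g (k, a)).2 <= b)%N) Hinf.
have [H2 H2inf [H21 H2P]] := pair_homogeneous (fun k a _ => (g (k, a)).1) H1inf.
exists H2 => //; split; first by move=> i /H21/H1H/HM.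
move=> k; have [c1 [n1 c1P]] := H1P k; have [c2 [n2 c2P]] := H2P k.
(* The eventual color can only be [true]: as [H1] is unbounded, each [a] has some [b'] in [H1]
   beyond its threshold. *)
have {}c1P a b : H1 a -> H1 b -> (n1 <= a)%N -> (a < b)%N ->
    ((g (k, a)).2 <= b)%N.
  move=> H1a H1b na ab; rewrite (c1P a b) //.
  have [b'] := (infinite_natP _).1 H1inf (maxn a.+1 (g (k, a)).2).
  by rewrite geq_max => H1b' /andP[ab' gb']; rewrite -(c1P a b').
exists c2, (maxn m (maxn n1 n2)) => u uH2 Btu.
have [u0|/fset_min[a au amin]] := eqVneq u fset0.
  by move: Btu; rewrite u0 fsetU0.
have [H2a /= /negP] := uH2 a au; rewrite -leqNgt !geq_max => /and3P[ma n1a n2a].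
have tuE : (t `|` u = a |` t `|` (u `\ a))%fset.
  by rewrite -fsetUA fsetUCA fsetD1K.
have [b H2b ab] := (infinite_natP _).1 H2inf a.+1.
rewrite -(c2P a b) // tuE; apply: (gP (k, a)) => //=; last by rewrite -tuE.
move=> i /=; rewrite !inE => /andP[ia iu]; have [H2i _] := uH2 i iu.
split; first exact/H1H/H21.
apply/negP; rewrite -leqNgt; apply: c1P => //; [exact: H21|exact: H21|].
by rewrite ltn_neqAle eq_sym ia amin.
Qed.

Hypothesis Bbar : barrier [set: nat] B.

Lemma densely_homogeneous0 : densely_homogeneous fset0.
Proof.
have [_ _ Banti Bfull] := Bbar; apply: contrapT => n0.
(* The number [mt.1] bounds the new element from below; using [n] at stage [n] makes the union of
   the branch infinite. *)
have /choice[next nextP] : forall mt : nat * {fset nat}, exists a,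
    ~ densely_homogeneous mt.2 ->
    (mt.1 <= a)%N /\ ~ densely_homogeneous (a |` mt.2)%fset.
  move=> -[m t] /=; apply: contrapT => noa.
  have tbad : ~ densely_homogeneous t.
    by move=> tgood; apply: noa; exists 0%N => /(_ tgood).
  (* A member of [B] has no proper superset in [B], so the only color above it is its own. *)
  have [Bt|nBt] := pselect (B t).
    apply: tbad => M Minf; exists M => //; split=> // k; exists (f t k), 0%N.
    by move=> u _ Btu; rewrite -(Banti _ _ Bt Btu) // fsubsetUl.
  apply: (tbad); apply: densely_homogeneous_step => //.
  exists m => a ma; apply: contrapT => abad; apply: noa.
  by exists a.
pose T := fix T n :=
  if n is n'.+1 then (next (n', T n') |` T n')%fset else fset0.
have Tbad n : ~ densely_homogeneous (T n).
  by elim: n => //= n IHn; have [] := nextP (n, T n) IHn.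
have Tmono m n : (m <= n)%N -> (T m `<=` T n)%fset.
  move=> /subnK <-; elim: (n - m)%N => [//|i IHi].
  exact: fsubset_trans IHi (fsubsetU1 _ _).
have [|//|s Bs [sT _]] := Bfull [set x | exists n, x \in T n].
  apply/infinite_natP => n; exists (next (n, T n)).
    by exists n.+1; rewrite /= !inE eqxx.
  by have [] := nextP (n, T n) (Tbad n).
(* Being finite, [s] is already included in some [T n], above which [s] is the only possible member
   of [B]. *)
have /choice[r rP] : forall x, exists n, x \in s -> x \in T n.
  move=> x; case: (boolP (x \in s)) => [xs|_]; last by exists 0%N.
  by have [n] := sT x xs; exists n.
pose n := \max_(x <- s) r x.
have sTn : (s `<=` T n)%fset.
  apply/fsubsetP => x xs; apply: (fsubsetP (Tmono (r x) n _)); last exact: rP.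
  exact: leq_bigmax_seq.
apply: (Tbad n) => M Minf; exists M => //; split=> // k; exists (f s k), 0%N.
move=> u _ Bu; rewrite -(Banti _ _ Bs Bu) //.
exact: fsubset_trans sTn (fsubsetUl _ _).
Qed.

End PairColorings.

Lemma barrier_seq_compact_cube (K : Type) (B : set {fset nat}) :
  ~ ([set: par2] #<= [set: K]) -> barrier [set: nat] B ->
  barrier_seq_compact B (cantor_cube K).
Proof.
move=> Klt Bbar f.
have [H Hinf [_ Hf]] := densely_homogeneous0 Klt f Bbar infinite_nat.
have /choice[x xP] := Hf.
exists H => //; exists x; apply/barrier_cvg_cubeP => k.
have [n nx] := xP k; exists n => s [Bs _] sH.
by rewrite -[s]fset0U; apply: nx => //; rewrite fset0U.
Qed.

(** * Nontrivial barriers and the failure of compactness *)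

Lemma initial_segment_total (s t N : set nat) :
  initial_segment s N -> initial_segment t N -> s `<=` t \/ t `<=` s.
Proof.
move=> [sN sI] [tN tI]; apply: contrapT.
move=> /not_orP[/existsNP[x /not_implyP[sx ntx]]].
move=> /existsNP[y /not_implyP[ty nsy]].
have [xy|yx|xy] := ltngtP x y; last by rewrite xy in sx.
  by apply: ntx; apply: (tI x y) => //; exact: sN.
by apply: nsy; apply: (sI y x) => //; exact: tN.
Qed.

(** Some singleton of [n] is missing from [B]. If that of some [m > n] were present, consider the
    member [t] of [B] that begins the set made of [n] and all numbers from [m] on: either [t]
    contains [m] and the antichain condition fails, or [t] is the missing singleton. *)
Lemma nontrivial_barrier_card (B : set {fset nat}) : nontrivial_barrier B ->
  exists k, forall s, B s -> (forall x, x \in s -> (k <= x)%N) ->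
    (1 < #|` s|)%N.
Proof.
move=> [[_ Bne Banti Bfull] Bnt].
have [n nBn] : exists n, ~ B [fset n]%fset.
  apply/existsNP => B1; apply: Bnt; apply/seteqP; split=> s /=.
    move=> Bs; have /fset0Pn[x xs] := (Bne _ Bs).1.
    by rewrite -(Banti _ _ (B1 x) Bs) ?cardfs1 ?fsub1set.
  by move=> /eqP/cardfs1P[x ->]; exact: B1.
exists n.+1 => s Bs sn; rewrite ltnNge; apply/negP => s1.
have /fset0Pn[m ms] := (Bne _ Bs).1.
have sE : s = [fset m]%fset.
  by apply/esym/eqP; rewrite eqEfcard fsub1set ms cardfs1.
have nm := sn _ ms.
have [|//|t Bt [tN tI]] := Bfull [set x | x = n \/ (m <= x)%N].
  by apply/infinite_natP => i; exists (maxn m i);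
    [right|]; rewrite ?leq_maxl ?leq_maxr.
have nt : n \in t.
  have /fset0Pn[x xt] := (Bne _ Bt).1.
  have [xn|mx] := tN x xt; first by rewrite -xn.
  by apply: (tI n x) => //; [left | exact: leq_trans nm mx].
have [mt|nmt] := boolP (m \in t).
  have st : s = t by apply: Banti => //; rewrite sE fsub1set.
  by move: nt nm; rewrite -st sE inE => /eqP ->; rewrite ltnn.
apply: nBn; suff <- : t = [fset n]%fset by [].
apply/fsetP => x; rewrite inE; apply/idP/eqP => [xt|-> //].
have [//|mx] := tN x xt; exfalso; move/negP: nmt; apply.
have [/eqP <- //|xm] := boolP (x == m).
by apply: (tI m x) => //; [right | rewrite ltn_neqAle eq_sym xm].
Qed.

Lemma not_barrier_seq_compact_par2 (B : set {fset nat}) :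
  nontrivial_barrier B -> ~ barrier_seq_compact B (cantor_cube par2).
Proof.
move=> Bnt; have [[_ _ _ Bfull] _] := Bnt.
have [d dP] := nontrivial_barrier_card Bnt.
have [[Pi PiW /card_eqPle[_ Pile]] _] := par2P.
have [h hP] : exists h : par2 -> coloring, set_surj [set: par2] Pi h.
  exact/pcard_surjP.
(* A member of [B] with at least two elements is colored by [h k] applied to
   its first two elements. *)
pose f (s : {fset nat}) : cantor_cube par2 := fun k =>
  `[< exists2 q : pairs, h k q & initial_segment [set` val q] [set` s] >].
move=> /(_ f)[M Minf [x /barrier_cvg_cubeP xP]]; apply: PiW; exists M => // p.
move=> /hP[k _ <-]; have [n nx] := xP k.
(* Discarding the elements below [d] ensures that the members of [B] in use have two elements;
   discarding those below [n] fixes their color. *)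
pose F := [fset i in iota 0 (maxn d n) | `[< M i >]]%fset.
exists F; first by move=> i /=; rewrite !inE => /andP[_ /asboolP].
exists (x k) => q qMF.
have qM i : i \in val q -> [/\ M i, (d <= i)%N & (n <= i)%N].
  move=> /qMF[Mi /= /negP]; rewrite !inE mem_iota add0n leq0n /= negb_and.
  by move=> /orP[|/asboolPn //]; rewrite -leqNgt geq_max => /andP[].
(* [N] starts with [q] and continues inside [M], so that a member of [B] beginning [N], having at
   least two elements, also starts with [q]. *)
pose N := [set` val q] `|` [set i | M i /\ forall j, j \in val q -> (j < i)%N].
have qN : initial_segment [set` val q] N.
  split=> [i|i j qj [//|[_ iq]] ij]; first by left.
  by have := iq _ qj; rewrite ltnNge ltnW.
have NM i : N i -> [/\ M i, (d <= i)%N & (n <= i)%N].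
  move=> [/qM //|[Mi iq]]; have /fset0Pn[j jq] : val q != fset0.
    by apply/eqP => q0; have := valP q; rewrite q0 cardfs0.
  have [_ dj nj] := qM _ jq; have ji := ltnW (iq _ jq).
  by split=> //; [exact: leq_trans dj ji | exact: leq_trans nj ji].
have [||s Bs sN] := Bfull N => //.
  apply/infinite_natP => i.
  have [j Mj] := (infinite_natP _).1 Minf (maxn i (\max_(j <- val q) j).+1).
  rewrite geq_max => /andP[ij qj]; exists j => //; right; split=> // l lq.
  by apply: leq_trans qj; rewrite ltnS (leq_bigmax_seq (F := id)).
have s2 : (1 < #|` s|)%N by apply: dP => // i /sN.1/NM[].
have card2 (q' : pairs) : #|` val q'| = 2%N := eqP (valP q').
have qs : initial_segment [set` val q] [set` s].
  have qsub : [set` val q] `<=` [set` s].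
    have [//|sq] := initial_segment_total qN sN.
    suff -> : s = val q by [].
    apply/eqP; rewrite eqEfcard card2 s2 andbT; apply/fsubsetP; exact: sq.
  split=> // i j qi sj; apply: qN.2 => //; exact: sN.1.
(* No pair other than [q] is an initial segment of [s], so [f s k] is exactly [h k q]. *)
rewrite -(nx s).
- apply/idP/asboolP => [hq|[q' hq' q's]]; first by exists q.
  suff -> : q = q' by [].
  apply/val_inj/eqP; rewrite eqEfcard !card2 leqnn andbT.
  have [/fsubsetP //|/fsubsetP q'q] := initial_segment_total qs q's.
  by have /eqP -> : val q' == val q by rewrite eqEfcard q'q !card2.
- by split=> // i /sN.1/NM[].
- by move=> i /sN.1/NM[Mi _ ni]; split=> //=; apply/negP; rewrite -leqNgt.
Qed.

Theorem corollary6p5 :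
  (forall (K : Type) (B : set {fset nat}),
      card_lt K par2 -> barrier [set: nat]%classic B ->
      barrier_seq_compact B (cantor_cube K)) /\
  (forall B : set {fset nat}, nontrivial_barrier B ->
      is_min_card (fun K : Type => ~ barrier_seq_compact B (cantor_cube K))
                  par2).
Proof.
split=> [K B [_]|B Bnt]; first exact: barrier_seq_compact_cube.
split=> [|K ncpt]; first exact: not_barrier_seq_compact_par2.
apply: contrapT => Klt; apply/ncpt/barrier_seq_compact_cube => //.
exact: Bnt.1.
Qed.
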